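(* For all integers $d\ge1$ and all integers $n\ge0$, $s_d(2n+1)\equiv 0\pmod{2^d}$.
   Context: Let $d\ge 1$ be an integer. A $d$-fold partition diamond consists of non-negative integers $a_i$ ($i\ge 0$) and $b_{i,j}$ ($i\ge 1$, $1\le j\le d$), only finitely many of which are nonzero, such that $a_{i-1}\ge b_{i,j}\ge a_i$ for all $i\ge1$ and $1\le j\le d$. For a Schmidt type $d$-fold partition diamond of $n$, only the links $a_i$ are summed: it is such a configuration with $\sum_{i\ge0}a_i=n$ (the $b_{i,j}$ are omitted from the sum, but configurations with different $b_{i,j}$ are counted as different). Let $s_d(n)$ be the number of Schmidt type $d$-fold partition diamonds of $n$. *)

(* Defs.v *)
From mathcomp Require Import all_boot finmap zify.
From mathcomp Require Import boolp classical_sets functions cardinality.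

Set Implicit Arguments.
Unset Strict Implicit.
Unset Printing Implicit Defensive.

Local Open Scope nat_scope.
Local Open Scope classical_set_scope.

(* The indices of the b's are shifted down to start from 0: the mathematical
   b_{i+1,j+1} is b (i, j), with i : nat and j : 'I_d.  In [diamond_config] the
   types {fsfun _ -> nat with 0} enforce that only finitely many of the a's and
   of the b's are nonzero. *)
Definition diamond_config (d : nat) : Type :=
  ({fsfun nat -> nat with 0} * {fsfun nat * 'I_d -> nat with 0})%type.

Definition is_partition_diamond (d : nat) (D : diamond_config d) : Prop :=
  forall (i : nat) (j : 'I_d), D.2 (i, j) <= D.1 i /\ D.1 i.+1 <= D.2 (i, j).

Definition link_sum (d : nat) (D : diamond_config d) : nat :=
  \sum_(i <- finsupp D.1) D.1 i.

Definition schmidt_diamonds (d n : nat) : set (diamond_config d) :=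
  [set D | is_partition_diamond D /\ link_sum D = n].
Arguments schmidt_diamonds d n : clear implicits.

(* [fset_set] is empty on infinite sets; [schmidt_diamonds_finite] below shows
   that this default is not used when 0 < d. *)
Definition schmidt_count (d n : nat) : nat :=
  #|` fset_set (schmidt_diamonds d n)|.

Section Finiteness.
Variables (d n : nat) (d_gt0 : 0 < d) (D : diamond_config d).
Hypothesis SD : schmidt_diamonds d n D.

Let link_noninc i k : D.1 (i + k) <= D.1 i.
Proof.
elim: k => [|k IH]; first by rewrite addn0.
case: SD => /(_ (i + k) (Ordinal d_gt0)) [h1 h2] _.
by rewrite addnS (leq_trans h2)// (leq_trans h1).
Qed.

Let link_bound i : i.+1 * D.1 i <= n.
Proof.
case: SD => _ <-; rewrite /link_sum.
have [Di0|Di_neq0] := eqVneq (D.1 i) 0; first by rewrite Di0 muln0.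
have sub : {subset iota 0 i.+1 <= finsupp D.1}.
  move=> k; rewrite mem_iota add0n ltnS => /= ki; rewrite mem_finsupp.
  have := link_noninc k (i - k); rewrite subnKC// => h.
  by apply/eqP => Dk0; move: h Di_neq0; rewrite Dk0 leqn0 => /eqP ->.
have -> : i.+1 * D.1 i = \sum_(k <- iota 0 i.+1) D.1 i.
  by rewrite big_const_seq count_predT size_iota iter_addn_0 mulnC.
have -> : \sum_(k <- finsupp D.1) D.1 k =
    \sum_(k <- iota 0 i.+1) D.1 k +
    \sum_(k <- finsupp D.1 | k \notin iota 0 i.+1) D.1 k.
  have us : uniq (iota 0 i.+1) by exact: iota_uniq.
  move: (iota 0 i.+1) us sub => s us sub.
  rewrite (bigID (mem s))/=; congr (_ + _).
  rewrite -big_filter; apply: perm_big; apply: uniq_perm => //.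
    by rewrite filter_uniq ?fset_uniq.
  by move=> k; rewrite mem_filter; case: (boolP (k \in s)) => //= /sub.
apply: leq_trans (leq_addr _ _); rewrite big_seq [leqRHS]big_seq.
apply: leq_sum => k; rewrite mem_iota add0n ltnS => /= ki.
by have := link_noninc k (i - k); rewrite subnKC.
Qed.

Lemma schmidt_link_le i : D.1 i <= n.
Proof. by rewrite (leq_trans _ (link_bound i))// leq_pmull. Qed.

Lemma schmidt_link_eq0 i : n <= i -> D.1 i = 0.
Proof. by move=> ni; have := link_bound i; case: (D.1 i) => // m; nia. Qed.

Lemma schmidt_side_le i j : D.2 (i, j) <= n.
Proof.
by case: SD => /(_ i j) [h _] _; rewrite (leq_trans h)// schmidt_link_le.
Qed.

Lemma schmidt_side_eq0 i j : n <= i -> D.2 (i, j) = 0.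
Proof.
move=> ni; case: SD => /(_ i j) [h _] _; move: h.
by rewrite schmidt_link_eq0// leqn0 => /eqP.
Qed.

End Finiteness.

Lemma schmidt_diamonds_finite (d n : nat) :
  0 < d -> finite_set (schmidt_diamonds d n).
Proof.
move=> d0.
pose T : finType :=
  ({ffun 'I_n -> 'I_n.+1} * {ffun 'I_n * 'I_d -> 'I_n.+1})%type.
pose g (D : diamond_config d) : T :=
  ([ffun i : 'I_n => inord (D.1 i)],
   [ffun p : 'I_n * 'I_d => inord (D.2 (val p.1, p.2))]).
have ginj : {in schmidt_diamonds d n &, injective g}.
  move=> D E /set_mem SD /set_mem SE [/ffunP e1 /ffunP e2].
  rewrite [D]surjective_pairing [E]surjective_pairing; congr pair.
    apply/fsfunP => i; have [ni|ni] := leqP n i.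
      by rewrite !(@schmidt_link_eq0 d n).
    have := e1 (Ordinal ni); rewrite !ffunE => /(congr1 val)/=.
    by rewrite !inordK// ltnS (@schmidt_link_le d n).
  apply/fsfunP => -[i j]; have [ni|ni] := leqP n i.
    by rewrite !(@schmidt_side_eq0 d n).
  have := e2 (Ordinal ni, j); rewrite !ffunE => /(congr1 val)/=.
  by rewrite !inordK// ltnS (@schmidt_side_le d n).
rewrite -(eq_finite_set (inj_card_eq ginj)).
exact: finite_finset.
Qed.

(* Main.v *)
Require Import Defs.
From mathcomp Require Import all_boot.
From mathcomp Require Import finmap zify.
From mathcomp Require Import classical_sets cardinality.

(** A diamond whose links have an odd sum has some odd link; let [l] be the
    index of the last one.  Then [a_l] is odd and [a_{l+1}] is even, so
    [c = a_l + a_{l+1}] is odd, and [b |-> c - b] is an involution of the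
    interval [a_{l+1} .. a_l] without a fixed point.  It exchanges the lower and
    the upper half of that interval.  Applying it independently to the [d]
    entries [b_{l,j}] makes the group of sign patterns ['I_d -> bool] act freely
    on the diamonds of a given odd link sum: neither the links nor [l] change,
    and every orbit has exactly one element in which all the [b_{l,j}] lie in
    the lower half.  Hence the number of diamonds is [2 ^ d] times the number of
    those elements. *)

Set Implicit Arguments.
Unset Strict Implicit.
Unset Printing Implicit Defensive.

(** Counting along a free action with a chosen section: [x] is recovered from
    its class [t] and from [move t x], which lies in the class [t0], so that [X]
    is in bijection with the product of that class and [T].  The involutivity
    of every [move t] reflects the elementary abelian 2-groups that this is
    meant for. *)
Lemma card_fset_section (K : choiceType) (T : finType) (X : {fset K})
    (class : K -> T) (t0 : T) (move : T -> K -> K) :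
  (forall t x, x \in X -> move t x \in X) ->
  (forall t x, x \in X -> move t (move t x) = x) ->
  (forall x, x \in X -> class (move (class x) x) = t0) ->
  (forall t x, x \in X -> class x = t0 -> class (move t x) = t) ->
  #|` X| = #|` [fset x in X | class x == t0]%fset| * #|T|.
Proof.
move=> moveX moveK class_t0 class_move.
pose f x := (move (class x) x, class x).
set Y := [fset x in X | class x == t0]%fset.
have inY x : (x \in Y) = (x \in X) && (class x == t0) by rewrite !inE.
rewrite cardE -[LHS](size_map f) -(size_allpairs pair Y (enum T)).
apply/perm_size/uniq_perm.
- rewrite map_inj_in_uniq ?fset_uniq// => x y xX yX [exy cxy].
  by rewrite -(moveK (class x) x xX) exy cxy moveK.
- by rewrite allpairs_uniq ?fset_uniq ?enum_uniq// => -[? ?] [? ?].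
move=> [y t]; apply/mapP/allpairsP => [[x xX [-> ->]]|[[y' t'] /= [+ _ [-> ->]]]].
  by exists (f x); rewrite inY mem_enum moveX//= class_t0.
rewrite inY => /andP[y'X /eqP y't0].
by exists (move t' y'); rewrite /f ?moveX// class_move// moveK.
Qed.

(** The maximum is attained: its default value 0 could only interfere if no
    entry of [s] were selected. *)
Lemma odd_bigmax (f : nat -> nat) (s : seq nat) :
  has (odd \o f) s -> odd (f (\max_(i <- s | odd (f i)) i)).
Proof.
elim: s => //= x s IH; rewrite big_cons.
case: ifP => //= fx _; case: (boolP (has (odd \o f) s)) => [/IH fm|s0].
  by rewrite /maxn; case: ifP.
by rewrite big_hasC ?maxn0.
Qed.

Definition last_odd (a : {fsfun nat -> nat with 0}) : nat :=
  \max_(i <- finsupp a | odd (a i)) i.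

(** This makes [a l + a l.+1] odd for [l := last_odd a].  Since [l] is a function
    of the links alone, it is preserved by every change of the sides. *)
Lemma odd_last_odd (a : {fsfun nat -> nat with 0}) :
  odd (\sum_(i <- finsupp a) a i) ->
  odd (a (last_odd a)) && ~~ odd (a (last_odd a).+1).
Proof.
move=> odd_a; apply/andP; split.
  apply: odd_bigmax; apply: contraLR odd_a => /hasPn even_a.
  rewrite big_seq; elim/big_ind: _ => //= x y.
  by rewrite oddD => /negbTE -> /negbTE ->.
apply/negP => odd_next.
have next_supp : (last_odd a).+1 \in finsupp a.
  by rewrite mem_finsupp; apply: contraTneq odd_next => ->.
suff : (last_odd a).+1 <= last_odd a by rewrite ltnn.
by move: next_supp odd_next; apply: leq_bigmax_seq.
Qed.

Section Reflection.
Variable d : nat.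
Implicit Types (D : diamond_config d) (t : {ffun 'I_d -> bool}).

Definition reflect_side t D (p : nat * 'I_d) : nat :=
  let l := last_odd D.1 in
  if (p.1 == l) && t p.2 then D.1 l + D.1 l.+1 - D.2 p else D.2 p.

(** The domain has to include the whole row [l], because a zero of [D.2] in this
    row may become nonzero. *)
Definition reflect_row t D : diamond_config d :=
  (D.1, [fsfun p in (finsupp D.2 `|` [fset (last_odd D.1, j) | j : 'I_d])%fset
          => reflect_side t D p | 0]).

(** The sides of the row [l] lying above its midpoint
    [(D.1 l + D.1 l.+1) / 2]. *)
Definition upper_sides D : {ffun 'I_d -> bool} :=
  let l := last_odd D.1 in [ffun j => D.1 l + D.1 l.+1 < (D.2 (l, j)).*2].

Lemma reflect_rowE t D p : (reflect_row t D).2 p = reflect_side t D p.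
Proof.
rewrite fsfunE; case: ifP => // /negbT; rewrite in_fsetU negb_or mem_finsupp.
rewrite negbK => /andP[/eqP p0 /imfsetP not_row].
rewrite /reflect_side; case: eqP => //= p1.
by case: not_row; exists p.2 => //; rewrite -p1; case: (p).
Qed.

Lemma reflect_row_diamond t D :
  is_partition_diamond D -> is_partition_diamond (reflect_row t D).
Proof.
move=> PD i j; rewrite reflect_rowE /reflect_side /=.
by have := PD i j; case: eqP => //= ->; case: (t j) => //; lia.
Qed.

Lemma reflect_rowK t D :
  is_partition_diamond D -> reflect_row t (reflect_row t D) = D.
Proof.
move=> PD; rewrite [RHS]surjective_pairing; congr pair; apply/fsfunP => -[i j].
have := PD i j; rewrite reflect_rowE /reflect_side reflect_rowE /reflect_side /=.
by case: eqP => //= ->; case: (t j) => //; lia.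
Qed.

(** The reflection exchanges the halves because no side equals the midpoint,
    which is not an integer when the link sum is odd. *)
Lemma upper_reflect_row t D :
  is_partition_diamond D -> odd (link_sum D) ->
  upper_sides (reflect_row t D) = [ffun j => t j (+) upper_sides D j].
Proof.
move=> PD /odd_last_odd /andP[odd_l even_l1].
apply/ffunP => j; rewrite !ffunE reflect_rowE /reflect_side /= eqxx /=.
by have := PD (last_odd D.1) j; case: (t j) => //=; lia.
Qed.

End Reflection.

Theorem theorem3p4 (d n : nat) (hd : 1 <= d) :
  schmidt_count d (2 * n + 1) = 0 %[mod 2 ^ d].
Proof.
have in_count D : D \in fset_set (schmidt_diamonds d (2 * n + 1)) ->
    is_partition_diamond D /\ link_sum D = 2 * n + 1.
  by rewrite in_fset_set ?inE; last exact: schmidt_diamonds_finite.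
have odd_count D : link_sum D = 2 * n + 1 -> odd (@link_sum d D) by lia.
rewrite /schmidt_count (@card_fset_section _ _ _ (@upper_sides d)
  [ffun=> false] (@reflect_row d)).
- by rewrite card_ffun card_bool card_ord modnMl mod0n.
- move=> t D /in_count[PD sD].
  rewrite in_fset_set ?inE; last exact: schmidt_diamonds_finite.
  by split; first exact: reflect_row_diamond.
- by move=> t D /in_count[PD _]; exact: reflect_rowK.
- move=> D /in_count[PD /odd_count oD]; rewrite upper_reflect_row//.
  by apply/ffunP => j; rewrite !ffunE addbb.
- move=> t D /in_count[PD /odd_count oD] D0; rewrite upper_reflect_row// D0.
  by apply/ffunP => j; rewrite !ffunE addbF.
Qed.
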